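(* Let $d\ge1$ and let $(Y_i)_{i\in\mathbb Z}$ be a strictly stationary sequence of random points, each uniformly distributed on $[0,1]^d$, with strong-mixing coefficients satisfying $\alpha(r)\le\varphi(r)$ for all $r\ge1$, where $\varphi:\mathbb N\to[0,\infty)$ satisfies $\sum_{r=0}^\infty r\,\varphi(r)<\infty$. Then for any finite collection of corner–point pairs $(c_a,p_a)_{a=1}^m$ and every $a,b\in\{1,\dots,m\}$, $$\sum_{r\in\mathbb Z}\left|\mathrm{Cov}\bigl(\xi_{c_a,p_a}(Y_0),\,\xi_{c_b,p_b}(Y_r)\bigr)\right|<\infty .$$ Consequently, for every $t\in\mathbb R^m$, the projection $X_i(t)=\sum_{a=1}^m t_a\,\xi_{c_a,p_a}(Y_i)$ has absolutely summable covariance series, i.e. $\sum_{r\in\mathbb Z}|\mathrm{Cov}(X_0(t),X_r(t))|<\infty$.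
   Context: A corner of $[0,1]^d$ is a function $c:\{0,\dots,d-1\}\to\{\mathrm{true},\mathrm{false}\}$; a corner–point pair $(c,p)$ consists of a corner $c$ and a point $p\in[0,1]^d$. $\mathrm{cornerLe}(c,p)=\{s\in[0,1]^d:\ \text{for all }k,\ s_k\ge p_k\text{ if }c(k)=\mathrm{true},\ s_k\le p_k\text{ if }c(k)=\mathrm{false}\}$, and $F^c(p)=\prod_{k=0}^{d-1}g_k(p)$ with $g_k(p)=1-p_k$ if $c(k)=\mathrm{true}$ and $g_k(p)=p_k$ otherwise. $\xi_{c,p}(y)=\mathbf 1\{y\in\mathrm{cornerLe}(c,p)\}-F^c(p)$. For $r\ge1$, $\alpha(r)=\sup_{m\in\mathbb Z}\alpha\bigl(\sigma(Y_i:i\le m),\sigma(Y_i:i\ge m+r)\bigr)$, where $\alpha(\mathcal A,\mathcal B)=\sup\{|\mathbb P(A\cap B)-\mathbb P(A)\mathbb P(B)|:A\in\mathcal A,B\in\mathcal B\}$. *)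

(* Defs.v *)
From HB Require Import structures.
From mathcomp Require Import all_boot all_order all_algebra.
From mathcomp Require Import all_classical all_reals all_analysis.
Set Implicit Arguments.
Unset Strict Implicit.
Unset Printing Implicit Defensive.
Import Order.TTheory GRing.Theory Num.Theory.
Import numFieldNormedType.Exports.
Local Open Scope classical_set_scope.
Local Open Scope ring_scope.

(* Points of R^d are d-tuples, which carry the product sigma-algebra. *)

Section cube.
Context {R : realType}.

Definition unit_cube (d : nat) : set (d.-tuple R) :=
  [set s | forall k, 0 <= tnth s k <= 1].

Definition corner (d : nat) := 'I_d -> bool.

Definition cornerLe (d : nat) (c : corner d) (p : d.-tuple R) :
    set (d.-tuple R) :=
  [set s | unit_cube s /\
     forall k, if c k then tnth p k <= tnth s k else tnth s k <= tnth p k].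

Definition corner_vol (d : nat) (c : corner d) (p : d.-tuple R) : R :=
  \prod_(k < d) (if c k then 1 - tnth p k else tnth p k).

Definition xi (d : nat) (c : corner d) (p y : d.-tuple R) : R :=
  \1_(cornerLe c p) y - corner_vol c p.

Definition xi_proj (d m : nat) (c : 'I_m -> corner d)
    (p : 'I_m -> d.-tuple R) (t : m.-tuple R) (y : d.-tuple R) : R :=
  \sum_(a < m) tnth t a * xi (c a) (p a) y.

End cube.

Section uniform_cube.
Context {R : realType}.

(* uniform_prob is declared on an alias of R with another display; this is the
   same set function on R itself. *)
Definition uniform01 : set R -> \bar R := uniform_prob (@ltr01 R).

Let uniform01_0 : uniform01 set0 = 0%E.
Proof. exact: (measure0 (uniform_prob (@ltr01 R))). Qed.

Let uniform01_ge0 A : (0 <= uniform01 A)%E.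
Proof. exact: (measure_ge0 (uniform_prob (@ltr01 R))). Qed.

Let uniform01_sigma_additive : semi_sigma_additive uniform01.
Proof. exact: (@measure_semi_sigma_additive _ _ _ (uniform_prob (@ltr01 R))). Qed.

HB.instance Definition _ := isMeasure.Build _ R R uniform01
  uniform01_0 uniform01_ge0 uniform01_sigma_additive.

Let uniform01_setT : uniform01 setT = 1%E.
Proof. exact: (probability_setT (uniform_prob (@ltr01 R))). Qed.

HB.instance Definition _ := Measure_isProbability.Build _ R R uniform01
  uniform01_setT.

Definition cons_pair (d : nat) (x : R * d.-tuple R) : d.+1.-tuple R :=
  [the d.+1.-tuple R of x.1 :: x.2].

Lemma measurable_cons_pair d : measurable_fun [set: R * d.-tuple R] (@cons_pair d).
Proof. exact: measurable_cons. Qed.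

HB.instance Definition _ (d : nat) :=
  isMeasurableFun.Build _ _ _ _ (@cons_pair d) (@measurable_cons_pair d).

(* The d-fold product of the uniform law on [0, 1]; it lives on R^d and is
   carried by the cube [0, 1]^d. *)
Fixpoint uniform_cube (d : nat) : probability (d.-tuple R) R :=
  match d with
  | 0 => \d_([tuple] : 0.-tuple R)
  | n.+1 => distribution (uniform01 \x uniform_cube n)%E
              (@cons_pair n)
  end.

Lemma uniform_cube_rect d (A : 'I_d -> set R) :
  (forall k, measurable (A k)) ->
  uniform_cube d [set s | forall k, A k (tnth s k)] =
    (\prod_(k < d) uniform01 (A k))%E.
Proof.
elim: d A => [|d IH] A mA.
  by rewrite big_ord0 /= diracE mem_set// => -[].
rewrite big_ord_recl /= /distribution /pushforward.
have -> : @cons_pair d @^-1` [set s | forall k, A k (tnth s k)] =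
    A ord0 `*` [set s | forall k, A (lift ord0 k) (tnth s k)].
  apply/seteqP; split => -[x s] /=.
    move=> H; split; first exact: (H ord0).
    by move=> k; move: (H (lift ord0 k)); rewrite tnthS.
  by move=> [H0 H] k; case: (unliftP ord0 k) => [j|] ->//; rewrite tnthS.
rewrite product_measure1E//.
  by congr (_ * _)%E; exact: (IH (fun k => A (lift ord0 k))).
rewrite (_ : mkset _ = \bigcap_(k in [set: 'I_d])
    ((fun s => tnth s k) @^-1` A (lift ord0 k))); last first.
  by apply/seteqP; split => s /= H k; [move=> _|]; exact: H.
apply: fin_bigcap_measurable => [|k _]; first exact: finite_finset.
by rewrite -[X in measurable X]setTI; exact: measurable_tnth.
Qed.

End uniform_cube.

Section process.
Context {d d' : measure_display} {T : measurableType d}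
  {T' : measurableType d'} {R : realType}.
Variable P : probability T R.

Definition strictly_stationary (Y : int -> T -> T') : Prop :=
  forall (n : nat) (i : 'I_n -> int) (h : int) (A : set (n.-tuple T')),
    measurable A ->
    P [set w | A [tuple Y (i k + h) w | k < n]] =
    P [set w | A [tuple Y (i k) w | k < n]].

Definition sigma_process (Y : int -> T -> T') (I : set int) : set (set T) :=
  <<s \bigcup_(i in I) preimage_set_system setT (Y i) measurable >>.

Definition alpha_coef (A B : set (set T)) : \bar R :=
  ereal_sup [set `|P (E `&` F) - P E * P F|%E | E in A & F in B].

Definition alpha_mixing (Y : int -> T -> T') (r : nat) : \bar R :=
  ereal_sup [set alpha_coef (sigma_process Y [set i | i <= m])
                            (sigma_process Y [set i | m + r%:Z <= i])
            | m in [set: int]].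

End process.

(* Main.v *)
(* The covariance of two centred indicators [1_A - u] and [1_B - v] is
   [P (A /\ B) - P A * P B].  With A an event of Y_0 and B an event of Y_r,
   this is at most alpha(|r|) in absolute value: split the time line at 0 when
   r > 0 and at r when r < 0.  The factor n >= 1 in the hypothesis on phi then
   leaves a summable majorant away from lag 0.  Projections follow by
   bilinearity of the covariance. *)
Require Import Defs.
From HB Require Import structures.
From mathcomp Require Import all_boot all_order all_algebra.
From mathcomp Require Import all_classical all_reals all_analysis.
Set Implicit Arguments.
Unset Strict Implicit.
Unset Printing Implicit Defensive.
Import Order.TTheory GRing.Theory Num.Theory.
Import numFieldNormedType.Exports.
Local Open Scope classical_set_scope.
Local Open Scope ring_scope.

(** The ranges of [Posz] and [Negz] partition the integers, and both maps are injective, so each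
    half of the sum transfers to the naturals. *)
Lemma summable_int (R : realType) (f : int -> \bar R) :
  summable [set: nat] (f \o Posz) -> summable [set: nat] (f \o Negz) ->
  summable [set: int] f.
Proof.
move=> fP fN; rewrite /summable (esumID (range Posz))//.
have -> : [set: int] `&` ~` range Posz = range Negz.
  rewrite setTI; apply/seteqP; split => [[n|n] /= h|_ [n _ <-] []//].
  - by case: h; exists n.
  - by exists n.
by rewrite setTI lte_add_pinfty// esum_image// => m n _ _ [].
Qed.

(** Lag 0 is only asked to be finite: the intended majorant [n * phi n] vanishes at 0 and bounds
    nothing there. *)
Lemma summable_int_le (R : realType) (f : int -> \bar R) (g : nat -> \bar R) :
  (`|f 0%R| < +oo)%E -> (forall n, 0 <= g n)%E ->
  (forall r : int, r != 0%R -> `|f r| <= g `|r|%N)%E ->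
  (\sum_(0 <= n <oo) g n < +oo)%E ->
  summable [set: int] f.
Proof.
move=> f0 g0 fg; rewrite nneseries_esumT// => sg.
apply: summable_int; rewrite /summable.
- rewrite (esumID [set 0%N])// setTI esum_set1// lte_add_pinfty//.
  apply: le_lt_trans sg; rewrite [leRHS](esumID [set 0%N])// setTI.
  apply: le_trans (leeDr _ _); last exact: esum_ge0.
  by apply: le_esum => n n0; apply: fg; apply/eqP => -[/n0].
(* [Negz n] has absolute value [n.+1], so the negative half is dominated by the part of the series
   of [g] indexed by the range of [S]. *)
- apply: le_lt_trans sg; rewrite [leRHS](esumID (range S))//.
  apply: le_trans (leeDl _ _); last exact: esum_ge0.
  rewrite setTI esum_image; last by move=> m n _ _ [].
  by apply: le_esum => n _; exact: fg.
Qed.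

Lemma summable_sum (R : realType) (T I : choiceType) (D : set T) (s : seq I)
    (f : I -> T -> \bar R) :
  (forall i, summable D (f i)) -> summable D (fun x => \sum_(i <- s) f i x)%E.
Proof.
move=> sf; elim: s => [|i s ih].
  rewrite /summable esum1// => x _.
  by rewrite big_nil abse0.
under eq_fun do rewrite big_cons.
exact: summableD.
Qed.

Lemma summableZl (R : realType) (T : choiceType) (D : set T) (k : R)
    (f : T -> \bar R) :
  summable D f -> summable D (fun x => k%:E * f x)%E.
Proof.
move=> sf; rewrite /summable.
under eq_esum do rewrite abseM.
apply: (@le_lt_trans _ _ (`|k%:E| * \esum_(x in D) `|f x|)%E); last first.
  by rewrite lte_mul_pinfty.
(* An upper bound suffices, so it is enough to pull the scalar out of each finite partial sum. *)
apply: ge_ereal_sup => _ [F [finF FD] <-].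
rewrite -ge0_mule_fsumr//.
by rewrite lee_wpmul2l//; apply: ereal_sup_ubound; exists F.
Qed.

Section covariance_extra.
Context (disp : measure_display) (T : measurableType disp) (R : realType).
Variable P : probability T R.

Lemma Lfun_indic (A : set T) (r : R) : r != 0 -> measurable A ->
  \1_A \in Lfun P r%:E.
Proof.
move=> r0 mA; rewrite inE; apply/andP; split; rewrite inE//=.
rewrite /finite_norm unlock poweR_lty//.
under eq_integral => x _.
  rewrite /= indicE normr_nat.
  (* An indicator is its own [r]-th power. Off [A] this uses [r != 0], since 0 to the power 0 is
     1. *)
  have -> : (x \in A)%:R `^ r = \1_A x.
    by rewrite indicE; case: (x \in A); rewrite ?powR1// powR0.
  over.
by rewrite integral_indic// setIT (le_lt_trans (probability_le1 P mA))// ltry.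
Qed.

Lemma covariance_indic (A B : set T) : measurable A -> measurable B ->
  covariance P \1_A \1_B = (P (A `&` B) - P A * P B)%E.
Proof.
move=> mA mB; have mAB : measurable (A `&` B) by exact: measurableI.
have ABE : \1_A * \1_B = \1_(A `&` B) :> (T -> R) by rewrite indicI.
by rewrite covarianceE ?ABE ?Lfun_indic ?oner_neq0// !expectation_indic.
Qed.

Lemma covariance_subcst (X Y : T -> R) (a b : R) :
  X \in Lfun P 2%:E -> Y \in Lfun P 2%:E ->
  covariance P (X \- cst a) (Y \- cst b) = covariance P X Y.
Proof.
move=> X2 Y2.
have Yb2 : Y \- cst b \in Lfun P 2%:E.
  by rewrite rpredB ?lee1n//= => ?; exact: Lfun_cst.
rewrite covarianceBl ?Lfun_cst//.
rewrite covariance_cst_l sube0 covarianceBr ?Lfun_cst//.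
by rewrite covariance_cst_r sube0.
Qed.

Lemma Lfun_scalel (X : T -> R) (k : R) :
  X \in Lfun P 2%:E -> (fun w => k * X w) \in Lfun P 2%:E.
Proof.
move=> X2; rewrite (_ : (fun _ => _) = k \o* X).
  by rewrite Lfun_scale// ler1n.
by apply/funext => w /=; rewrite mulrC.
Qed.

Lemma Lfun_sumZ (I : eqType) (s : seq I) (t : I -> R) (X : I -> T -> R) :
  (forall i, X i \in Lfun P 2%:E) ->
  (fun w => \sum_(i <- s) t i * X i w) \in Lfun P 2%:E.
Proof.
move=> X2; elim: s => [|i s ih].
  by under eq_fun do rewrite big_nil; exact: Lfun_cst.
under eq_fun do rewrite big_cons.
by apply: rpredD => //; [rewrite lee1n|move=> ?; exact: Lfun_scalel].
Qed.

Lemma covariance_sumZl (I : eqType) (s : seq I) (t : I -> R)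
    (X : I -> T -> R) (Y : T -> R) :
  (forall i, X i \in Lfun P 2%:E) -> Y \in Lfun P 2%:E ->
  covariance P (fun w => \sum_(i <- s) t i * X i w) Y =
  (\sum_(i <- s) (t i)%:E * covariance P (X i) Y)%E.
Proof.
move=> X2 Y2.
(* [P] is finite, so square-integrable functions are integrable; [covarianceZl] asks for
   integrability of both factors and of their product. *)
have L1 : {subset Lfun P 2%:E <= Lfun P 1}.
  by apply: Lfun_subset12; exact: fin_num_measure.
elim: s => [|i s ih].
  by under eq_fun do rewrite big_nil; rewrite big_nil covariance_cst_l.
under eq_fun do rewrite big_cons.
rewrite big_cons -ih covarianceDl ?Lfun_scalel ?Lfun_sumZ//.
congr (_ + _)%E.
rewrite -covarianceZl; [|exact: L1|exact: L1|exact: Lfun2_mul_Lfun1].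
by congr covariance; apply/funext => w /=; rewrite mulrC.
Qed.

End covariance_extra.

Section mixing.
Context (disp disp' : measure_display) (T : measurableType disp)
  (T' : measurableType disp') (R : realType).
Variables (P : probability T R) (Y : int -> T -> T').

Lemma sigma_process_preimage (I : set int) (i : int) (A : set T') :
  I i -> measurable A -> sigma_process Y I (Y i @^-1` A).
Proof.
move=> Ii mA; apply: sub_sigma_algebra; exists i => //.
by exists A => //; rewrite setTI.
Qed.

Lemma le_alpha_mixing (m : int) (r : nat) (E F : set T) :
  sigma_process Y [set i | i <= m] E ->
  sigma_process Y [set i | m + r%:Z <= i] F ->
  (`|P (E `&` F) - P E * P F| <= alpha_mixing P Y r)%E.
Proof.
move=> sE sF.
apply: (@le_trans _ _ (alpha_coef P (sigma_process Y [set i | i <= m])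
    (sigma_process Y [set i | m + r%:Z <= i]))).
  by apply: ereal_sup_ubound; exists E => //; exists F.
by apply: ereal_sup_ubound; exists m.
Qed.

Lemma le_alpha_mixing_preimage (r : int) (A B : set T') :
  measurable A -> measurable B ->
  (`|P (Y 0 @^-1` A `&` Y r @^-1` B) - P (Y 0 @^-1` A) * P (Y r @^-1` B)|
    <= alpha_mixing P Y `|r|%N)%E.
Proof.
move=> mA mB; have [r0|r0] := leP 0 r.
  apply: (@le_alpha_mixing 0); apply: sigma_process_preimage => //=.
  by rewrite add0r gez0_abs.
(* For negative [r] the event of [Y r] is the past one, so the two events are swapped; the future
   then starts at [r + |r| = 0]. *)
rewrite setIC muleC; apply: (@le_alpha_mixing r).
  by apply: sigma_process_preimage => //=.
by apply: sigma_process_preimage => //=; rewrite ltz0_abs// subrr.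
Qed.

End mixing.

(** The set is a box: a finite intersection of preimages, under the coordinate maps, of its sides
    [I k]. *)
Lemma measurable_cornerLe (R : realType) (d : nat) (c : corner d)
    (p : d.-tuple R) : measurable (cornerLe c p).
Proof.
pose I k : set R := `[0, 1] `&`
  (if c k then `[tnth p k, +oo[ else `]-oo, tnth p k])%classic.
rewrite (_ : cornerLe c p = \bigcap_(k in [set: 'I_d])
    ((fun s => tnth s k) @^-1` I k)); last first.
  apply/seteqP; split => [s [us cs] k _|s Is].
  - split; first by rewrite /= in_itv; exact: us.
    by have := cs k; rewrite /I; case: (c k); rewrite /= in_itv/= ?andbT.
  - split=> k; have [] := Is k Logic.I; rewrite /= in_itv//= => _.
    by rewrite /I; case: (c k); rewrite /= in_itv/= ?andbT.
apply: fin_bigcap_measurable => [|k _]; first exact: finite_finset.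
rewrite -[X in measurable X]setTI; apply: measurable_tnth => //.
by apply: measurableI; [|case: (c k)]; exact: measurable_itv.
Qed.

Theorem theorem3p15 (R : realType) (disp : measure_display)
    (Omega : measurableType disp) (P : probability Omega R)
    (d : nat) (hd : (1 <= d)%N)
    (Y : int -> {RV P >-> d.-tuple R})
    (hstat : strictly_stationary P (fun i => Y i : Omega -> d.-tuple R))
    (hunif : forall (i : int) (A : set (d.-tuple R)), measurable A ->
      distribution P (Y i) A = uniform_cube d A)
    (phi : nat -> R) (hphi0 : forall r, 0 <= phi r)
    (hmix : forall r : nat, (1 <= r)%N ->
      (alpha_mixing P (fun i => Y i : Omega -> d.-tuple R) r <= (phi r)%:E)%E)
    (hphi : (\sum_(0 <= r <oo) (r%:R * phi r)%:E < +oo)%E)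
    (m : nat) (c : 'I_m -> corner d) (p : 'I_m -> d.-tuple R)
    (hp : forall a, unit_cube (p a)) :
  (forall a b : 'I_m,
     summable [set: int] (fun r : int =>
       covariance P (xi (c a) (p a) \o Y 0) (xi (c b) (p b) \o Y r)))
  /\
  (forall t : m.-tuple R,
     summable [set: int] (fun r : int =>
       covariance P (xi_proj c p t \o Y 0) (xi_proj c p t \o Y r))).
Proof.
have mA a i : measurable (Y i @^-1` cornerLe (c a) (p a)).
  by rewrite -[X in measurable X]setTI; apply: measurable_funPT => //;
    exact: measurable_cornerLe.
have xiE a i : xi (c a) (p a) \o Y i =
    \1_(Y i @^-1` cornerLe (c a) (p a)) \- cst (corner_vol (c a) (p a)).
  by apply/funext => w /=; rewrite /xi !indicE.
have xi2 a i : xi (c a) (p a) \o Y i \in Lfun P 2%:E.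
  by rewrite xiE rpredB ?lee1n//= => ?; [exact: Lfun_indic|exact: Lfun_cst].
have sxi a b : summable [set: int] (fun r : int =>
    covariance P (xi (c a) (p a) \o Y 0) (xi (c b) (p b) \o Y r)).
  (* The centring constants drop out of the covariance, so their actual value [corner_vol] does not
     matter. *)
  under eq_fun do rewrite !xiE covariance_subcst ?Lfun_indic// covariance_indic//.
  (* The majorant is [n * phi n]. Lag 0 is finite because probabilities are; at other lags
     [|r| >= 1] gives both the mixing bound and [phi |r| <= |r| * phi |r|]. *)
  apply: summable_int_le hphi => [|n|r r0].
  - by rewrite ltey_eq abse_fin_num fin_numB fin_numM ?fin_num_measure//;
      exact: measurableI.
  - by rewrite lee_fin mulr_ge0.
  - have r1 : (1 <= `|r|)%N by rewrite absz_gt0.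
    have mC e : measurable (cornerLe (c e) (p e)).
      exact: measurable_cornerLe.
    apply: le_trans (le_alpha_mixing_preimage P Y r (mC a) (mC b)) _.
    by apply: le_trans (hmix _ r1) _; rewrite lee_fin ler_peMl// ler1n.
split=> // t.
have projE i : xi_proj c p t \o Y i =
    (fun w => \sum_(a < m) tnth t a * (xi (c a) (p a) \o Y i) w) by [].
have proj2 i : xi_proj c p t \o Y i \in Lfun P 2%:E.
  by rewrite projE; exact: Lfun_sumZ.
(* [covariance_sumZl] expands the left argument only, so symmetry moves the second projection to the
   left and then back. What results is a finite double sum of the series in [sxi] with constant
   weights. *)
under eq_fun => r.
  rewrite [X in covariance P X]projE covariance_sumZl//.
  under eq_bigr => a _.
    rewrite covarianceC projE covariance_sumZl//.
    under eq_bigr do rewrite covarianceC.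
    over.
  over.
apply: summable_sum => a; apply: summableZl.
by apply: summable_sum => b; exact: summableZl.
Qed.
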